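(* For $r\in(0,1)$, let $Z_r=\sum_{k=1}^\infty B_{k}$, where $(B_k)_{k\ge1}$ are independent Bernoulli random variables (depending on $r$) with $\mathbb P[B_k=1]=1-\mathbb P[B_k=0]=r^{2k}$. Set $h=\frac{4\pi r^2}{1-r^2}$ and write $Z^h=Z_r$. Then there exist a constant $C\le166$ and $h_0>0$ such that for all $h\ge h_0$ $$d_{\mathrm{Kol}}\left(\frac{Z^h-\frac{h}{4\pi}}{\sqrt{\mathrm{Var}(Z^h)}}\,,\,\mathcal N_{\mathbb R}(0,1)\right)\le\frac{C}{\sqrt h}.$$
   Context: $d_{\mathrm{Kol}}(X,Y)=\sup_{a\in\mathbb R}|\mathbb P[X\le a]-\mathbb P[Y\le a]|$ is the Kolmogorov distance between the laws of $X$ and $Y$; $\mathcal N_{\mathbb R}(0,1)$ is the standard Gaussian law. The map $r\mapsto h$ is a bijection from $(0,1)$ to $(0,\infty)$, so $Z^h$ is well defined. *)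

(* Defs.v *)
From HB Require Import structures.
From mathcomp Require Import all_boot all_order all_algebra finmap.
From mathcomp Require Import all_classical all_reals all_analysis measurable_realfun.

Set Implicit Arguments.
Unset Strict Implicit.
Unset Printing Implicit Defensive.

Import Order.TTheory GRing.Theory Num.Theory.
Import numFieldNormedType.Exports.

Local Open Scope classical_set_scope.
Local Open Scope ring_scope.

(* Mutual independence of the family (X i), i in D: the product rule for every
   finite subfamily and all measurable sets. *)
Definition mutually_independent (R : realType) (d d' : measure_display)
    (T : measurableType d) (T' : measurableType d') (P : probability T R)
    (I : choiceType) (D : set I) (X : I -> {RV P >-> T'}) : Prop :=
  forall (J : {fset I}) (A : I -> set T'),
    [set` J] `<=` D -> (forall i, i \in J -> measurable (A i)) ->
    P (\bigcap_(i in [set` J]) (X i @^-1` A i)) =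
    (\prod_(i <- J) P (X i @^-1` A i))%E.

Arguments mutually_independent {R d d' T T'} P {I} D X.

Definition is_bernoulli (R : realType) (d : measure_display)
    (T : measurableType d) (P : probability T R) (p : R) (X : {RV P >-> R}) :
    Prop :=
  P (X @^-1` [set 1]) = p%:E /\ P (X @^-1` [set 0]) = (1 - p)%:E.

Arguments is_bernoulli {R d T} P p X.

Definition dKol (R : realType) (d d' : measure_display)
    (T : measurableType d) (P : probability T R) (X : {RV P >-> R})
    (T' : measurableType d') (P' : probability T' R) (Y : {RV P' >-> R}) :
    \bar R :=
  ereal_sup [set `|cdf X a - cdf Y a|%E | a in [set: R]].

Arguments dKol {R d d' T} P X {T'} P' Y.

Section sum_RV.
Context (R : realType) (d : measure_display) (T : measurableType d).

(* The pointwise sum of X 1 + X 2 + ...; where the series diverges, [limn] is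
   a fixed default value, so that [sum_RV X] is a genuine random variable. *)
Definition sum_RV (X : nat -> {mfun T >-> R}) : T -> R :=
  fun w => limn (fun n => \sum_(1 <= k < n.+1) X k w).

Lemma limn_limn_esup (u : R^nat) :
  limn u = if (limn_einf (EFin \o u) == limn_esup (EFin \o u)) &&
              (limn_esup (EFin \o u) \is a fin_num)
           then fine (limn_esup (EFin \o u)) else point.
Proof.
have [cu|ncu] := pselect (cvgn u).
  have eu : EFin \o u @ \oo --> (limn u)%:E.
    by apply: cvg_EFin => //; exact: nearW.
  by have [-> ->] := cvg_limn_einf_sup eu; rewrite eqxx.
case: ifPn => [/andP[/eqP eu fu]|_]; last by rewrite dvgP.
exfalso; apply: ncu; apply/cvg_ex; exists (fine (limn_esup (EFin \o u))).
rewrite -[u]/(fine \o (EFin \o u)); apply: fine_cvg; rewrite fineK//.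
apply: (@squeeze_cvge _ _ _ _ (einfs (EFin \o u)) _ (esups (EFin \o u))).
- apply: nearW => n; apply/andP; split.
  + by apply: ereal_inf_lbound; exists n => /=.
  + by apply: ereal_sup_ubound; exists n => /=.
- by rewrite -eu limn_einf_lim; exact: is_cvg_einfs.
- by rewrite limn_esup_lim; exact: is_cvg_esups.
Qed.

Lemma measurable_sum_RV (X : nat -> {mfun T >-> R}) :
  measurable_fun [set: T] (sum_RV X).
Proof.
pose u w n := \sum_(1 <= k < n.+1) X k w.
have mu n : measurable_fun [set: T] (fun w => (EFin \o u w) n).
  by apply/measurable_EFinP; exact: measurable_sum.
have ms : measurable_fun [set: T] (fun w => limn_esup (EFin \o u w)).
  exact: (measurable_fun_limn_esup (f := fun n w => (EFin \o u w) n)).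
have mi : measurable_fun [set: T] (fun w => limn_einf (EFin \o u w)).
  rewrite /limn_einf; apply: measurableT_comp => //.
  apply: (measurable_fun_limn_esup (f := fun n w => (- (EFin \o u w) n)%E)).
  by move=> n; exact: measurableT_comp.
rewrite (_ : sum_RV X = fun w =>
    if (limn_einf (EFin \o u w) == limn_esup (EFin \o u w)) &&
       (limn_esup (EFin \o u w) \is a fin_num)
    then fine (limn_esup (EFin \o u w)) else point); last first.
  by apply/funext => w; rewrite /sum_RV limn_limn_esup.
apply: measurable_fun_ifT => //.
- apply: measurable_and; first exact: measurable_fun_eqe.
  apply: (measurable_fun_bool true).
  exact: (emeasurable_fin_num measurableT ms).
- exact: measurableT_comp.
Qed.

HB.instance Definition _ (X : nat -> {mfun T >-> R}) :=
  isMeasurableFun.Build _ _ _ _ (sum_RV X) (measurable_sum_RV X).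

Definition shift_scale (m s : R) (X : {mfun T >-> R}) : T -> R :=
  fun w => (X w - m) / s.

Lemma measurable_shift_scale m s (X : {mfun T >-> R}) :
  measurable_fun [set: T] (shift_scale m s X).
Proof. by apply: measurable_funM => //; exact: measurable_funB. Qed.

HB.instance Definition _ m s (X : {mfun T >-> R}) :=
  isMeasurableFun.Build _ _ _ _ (shift_scale m s X)
    (measurable_shift_scale m s X).

End sum_RV.

(* The identity of the line; on the probability space (R, [normal_prob 0 1]) it
   is a standard Gaussian variable.  [normal_prob] lives on [measurableTypeR R],
   whose display differs from that of the canonical structure on [R]. *)
Definition idTR (R : realType) : measurableTypeR R -> R := idfun.

Lemma measurable_idTR (R : realType) : measurable_fun [set: _] (@idTR R).
Proof. by move=> _ A mA; rewrite setTI. Qed.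

HB.instance Definition _ (R : realType) :=
  isMeasurableFun.Build _ _ _ _ (@idTR R) (@measurable_idTR R).

(* Main.v *)
Require Import Defs.
From mathcomp Require Import all_boot all_order all_algebra finmap.
From mathcomp Require Import all_classical all_reals all_analysis measurable_realfun.
From mathcomp Require Import ring lra.

Import Order.TTheory GRing.Theory Num.Theory.
Import numFieldNormedType.Exports.

Local Open Scope classical_set_scope.
Local Open Scope ring_scope.

(** Stein's method in its discrete form.  For a sum S of independent Bernoulli
    variables with parameters p_k, mean m and variance s^2,
      E[(S - m) g(S)] = sum_k p_k (1 - p_k) E[g(S_k + 1) - g(S_k)],
    S_k being S without its k-th term.  Take g(j) = f((j - m) / s), with f the
    bounded solution of Stein's equation for the indicator of (-oo, a].  By the
    equation, on a cell between two consecutive values of (S - m) / s, the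
    quantity w f(w) + 1_(w <= a) - Phi(a) at an endpoint differs from the
    difference quotient of f by at most the increment of
    b(w) = w f(w) - 1_(w <= a), because w f(w) is nondecreasing (a form of
    Mills' inequalities).  The same identity applied to b, with |b| <= 2, then
    bounds the Kolmogorov distance by E[|S - m|] * 2 / s^2 <= 2 / s.

    Both sides pass to the limit along partial sums, since Borel-Cantelli makes
    the series a finite sum almost surely.  With q = r^2 the variance of the
    series is q / (1 - q^2) >= h / (8 pi), so C = 12 suffices. *)

(** * Sums of finitely many Bernoulli variables *)

Section poisson_binomial.
Context {R : realType}.
Implicit Types (p : R) (s : seq R) (g : nat -> R).

(* Expectation of [g] at a sum of independent Bernoulli variables whose
   parameters are the entries of [s]. *)
Fixpoint pbE s g : R :=
  if s is p :: s' then (1 - p) * pbE s' g + p * pbE s' (g \o S) else g 0%N.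

(* Sum over [k] of [s_k (1 - s_k)] times the expectation of [g] of the sum in
   which the [k]-th Bernoulli variable is left out. *)
Fixpoint pbL s g : R :=
  if s is p :: s' then p * (1 - p) * pbE s' g
                       + (1 - p) * pbL s' g + p * pbL s' (g \o S)
  else 0.

Definition pb_mean s : R := \sum_(p <- s) p.
Definition pb_var s : R := \sum_(p <- s) p * (1 - p).

Let pb01 s := forall p, p \in s -> 0 <= p <= 1.

Lemma pb01_cons p s : pb01 (p :: s) -> [/\ 0 <= p, 0 <= 1 - p & pb01 s].
Proof.
move=> h; have /andP[p0 p1] := h p (mem_head _ _); split => //.
  by rewrite subr_ge0.
by move=> x xs; apply: h; rewrite inE xs orbT.
Qed.

Lemma pbE_lin s (a b : R) g1 g2 :
  pbE s (fun j => a * g1 j + b * g2 j) = a * pbE s g1 + b * pbE s g2.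
Proof.
elim: s g1 g2 => [//|p s IH] g1 g2 /=.
rewrite IH.
have -> : pbE s ((fun j => a * g1 j + b * g2 j) \o S)
  = a * pbE s (g1 \o S) + b * pbE s (g2 \o S) by exact: IH.
by ring.
Qed.

Lemma pbL_lin s (a b : R) g1 g2 :
  pbL s (fun j => a * g1 j + b * g2 j) = a * pbL s g1 + b * pbL s g2.
Proof.
elim: s g1 g2 => [|p s IH] g1 g2 /=; first by rewrite !mulr0 addr0.
rewrite pbE_lin IH.
have -> : pbL s ((fun j => a * g1 j + b * g2 j) \o S)
  = a * pbL s (g1 \o S) + b * pbL s (g2 \o S) by exact: IH.
by ring.
Qed.

Lemma pbE_cst s (c : R) : pbE s (fun=> c) = c.
Proof.
elim: s => [//|p s IH] /=; rewrite -[X in p * X]/(pbE s (fun=> c)) !IH.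
by ring.
Qed.

Lemma pbE_le s g1 g2 : pb01 s ->
  (forall j, g1 j <= g2 j) -> pbE s g1 <= pbE s g2.
Proof.
elim: s g1 g2 => [|p s IH] g1 g2; first by move=> _; apply.
move=> /pb01_cons[p0 p1 s01] g12 /=.
by rewrite lerD// ler_wpM2l// IH// => j; exact: g12.
Qed.

Lemma pbL_cst1 s : pbL s (fun=> 1) = pb_var s.
Proof.
rewrite /pb_var; elim: s => [|p s IH]; first by rewrite big_nil.
rewrite big_cons /= pbE_cst -[X in _ + p * X]/(pbL s (fun=> 1)) !IH.
by ring.
Qed.

(** Discrete integration by parts. The head variable contributes [- p] or [1 - p] to the centred
    factor, with weights [1 - p] and [p], hence [p * (1 - p)] times a difference of [g]; induction
    covers the other variables. *)
Lemma pbE_center s g :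
  pbE s (fun j => (j%:R - pb_mean s) * g j) = pbL s (fun j => g j.+1 - g j).
Proof.
rewrite /pb_mean; elim: s g => [|p s IH] g /=.
  by rewrite big_nil subrr mul0r.
rewrite big_cons; set m := \sum_(q <- s) q in IH *.
have -> : pbE s (fun j => (j%:R - (p + m)) * g j)
    = pbE s (fun j => 1 * ((j%:R - m) * g j) + (- p) * g j).
  by congr pbE; apply/funext => j; ring.
have -> : pbE s ((fun j => (j%:R - (p + m)) * g j) \o S)
    = pbE s (fun j => 1 * ((j%:R - m) * (g \o S) j) + (1 - p) * (g \o S) j).
  by congr pbE; apply/funext => j /=; rewrite -[j.+1]addn1 natrD; ring.
have -> : pbE s (fun j => g j.+1 - g j)
    = pbE s (fun j => 1 * (g \o S) j + (-1) * g j).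
  by congr pbE; apply/funext => j /=; ring.
rewrite !pbE_lin !IH.
rewrite -[pbL s (_ \o S)]/(pbL s (fun j => (g \o S) j.+1 - (g \o S) j)).
by ring.
Qed.

(** [pbE_center] applied to a function whose increments are all 1. *)
Lemma pbE_var s :
  pbE s (fun j => (j%:R - pb_mean s) ^+ 2) = pb_var s.
Proof.
have -> : pbE s (fun j => (j%:R - pb_mean s) ^+ 2)
    = pbE s (fun j => (j%:R - pb_mean s) * (j%:R - pb_mean s)).
  by congr pbE; apply/funext => j; rewrite expr2.
rewrite (pbE_center s (fun j => j%:R - pb_mean s)) -pbL_cst1.
by congr pbL; apply/funext => j; rewrite -[j.+1]addn1 natrD; ring.
Qed.

(** The mean absolute deviation is at most the standard deviation. *)
Lemma pbE_center_le s g (M : R) : pb01 s -> 0 < pb_var s ->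
  (forall j, `|g j| <= M) ->
  pbE s (fun j => (j%:R - pb_mean s) * g j) <= M * Num.sqrt (pb_var s).
Proof.
move=> s01 V0 gM; set sd := Num.sqrt _; set m := pb_mean s.
have sd0 : 0 < sd by rewrite sqrtr_gt0.
have sd2 : sd ^+ 2 = pb_var s by rewrite sqr_sqrtr// ltW.
have M0 : 0 <= M by rewrite (le_trans _ (gM 0%N)).
(* AM-GM: [|t| <= t^2 / (2 sd) + sd / 2]. *)
apply: (@le_trans _ _ (pbE s (fun j => (M / (2 * sd)) * (j%:R - m) ^+ 2
    + (M * sd / 2) * 1))).
  apply: pbE_le => // j; set t := j%:R - m.
  apply: (le_trans (ler_norm _)); rewrite normrM.
  apply: (@le_trans _ _ (`|t| * M)); first by rewrite ler_wpM2l.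
  rewrite -subr_ge0.
  have -> : M / (2 * sd) * t ^+ 2 + M * sd / 2 * 1 - `|t| * M
     = M / (2 * sd) * (`|t| - sd) ^+ 2.
    by rewrite -(real_normK (num_real t)); field; rewrite gt_eqF.
  by rewrite mulr_ge0 ?sqr_ge0// divr_ge0// mulr_ge0// ltW.
rewrite pbE_lin pbE_cst pbE_var -sd2 le_eqVlt; apply/orP; left; apply/eqP.
by field; rewrite gt_eqF.
Qed.

(* Each cell [j, j+1] of a leave-one-out sum carries the two possible values of
   the full sum. *)
Lemma pb_var_pbE_pbL_le s (F c e : nat -> R) : pb01 s ->
  (forall j, F j - c j <= e j) -> (forall j, F j.+1 - c j <= e j) ->
  pb_var s * pbE s F - pbL s c <= pbL s e.
Proof.
elim: s F c e => [|p s IH] F c e; first by rewrite /pb_var big_nil/= !mul0r subr0.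
move=> /pb01_cons[p0 p1 s01] h1 h2; rewrite /pb_var big_cons -/(pb_var s) /=.
have i1 := IH F c e s01 h1 h2.
have i2 := IH (F \o S) (c \o S) (e \o S) s01 (fun j => h1 j.+1) (fun j => h2 j.+1).
(* Here the head variable is the one left out: its two values put [F] at the two ends of the cell,
   with weights [1 - p] and [p]. *)
have i3 : (1 - p) * pbE s F + p * pbE s (F \o S) - pbE s c <= pbE s e.
  have -> : (1 - p) * pbE s F + p * pbE s (F \o S) - pbE s c =
     pbE s (fun j => 1 * ((1 - p) * F j + p * (F \o S) j) + (-1) * c j).
    by rewrite !pbE_lin; ring.
  apply: pbE_le => // j /=.
  have -> : 1 * ((1 - p) * F j + p * F j.+1) + -1 * c j =
    (1 - p) * (F j - c j) + p * (F j.+1 - c j) by ring.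
  have -> : e j = (1 - p) * e j + p * e j by ring.
  by rewrite lerD// ler_wpM2l.
(* The three weights are those in the recursion of [pbL]. *)
have h := lerD (ler_wpM2l (mulr_ge0 p0 p1) i3)
  (lerD (ler_wpM2l p1 i1) (ler_wpM2l p0 i2)).
rewrite -subr_ge0 in h; rewrite -subr_ge0; apply: le_trans h _.
by rewrite le_eqVlt; apply/orP; left; apply/eqP; ring.
Qed.

(** By [pbE_center], the variance times the expectation of [x j * f j] is [pbL s c]. These cancel,
    so [pb_var s * pbE s phi] is at most [pbL] of the increments of [b], which [pbE_center] turns
    into a centred expectation bounded by [M * sd]. *)
Lemma pb_stein_le s (f b phi : nat -> R) (M : R) : pb01 s -> 0 < pb_var s ->
  let sd := Num.sqrt (pb_var s) in
  let x (j : nat) := (j%:R - pb_mean s) / sd in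
  let c j := sd * (f j.+1 - f j) in
  (forall j, x j * f j + phi j - c j <= b j.+1 - b j) ->
  (forall j, x j.+1 * f j.+1 + phi j.+1 - c j <= b j.+1 - b j) ->
  (forall j, `|b j| <= M) ->
  pbE s phi <= M / sd.
Proof.
move=> s01 V0 sd x c h1 h2 bM.
have sd0 : 0 < sd by rewrite sqrtr_gt0.
have sd2 : pb_var s = sd ^+ 2 by rewrite sqr_sqrtr// ltW.
have := @pb_var_pbE_pbL_le s (fun j => x j * f j + phi j) c
  (fun j => b j.+1 - b j) s01 h1 h2.
rewrite -[pbL s (fun j => b j.+1 - b j)]pbE_center.
move=> /le_trans /(_ (pbE_center_le _ _ _ s01 V0 bM)).
have -> : pbL s c = pbL s (fun j => sd * (f j.+1 - f j) + 0 * 0).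
  by congr pbL; apply/funext => j; rewrite mul0r addr0.
rewrite (pbL_lin s sd 0 (fun j => f j.+1 - f j) (fun=> 0)) mul0r addr0.
rewrite -pbE_center.
have -> : pbE s (fun j => x j * f j + phi j) =
    pbE s (fun j => sd^-1 * ((j%:R - pb_mean s) * f j) + 1 * phi j).
  by congr pbE; apply/funext => j; rewrite /x; ring.
rewrite pbE_lin -/sd sd2 => h.
rewrite ler_pdivlMr// -(ler_pM2l sd0) [leRHS]mulrC -subr_ge0.
rewrite -subr_ge0 in h; apply: le_trans h _.
by rewrite le_eqVlt; apply/orP; left; apply/eqP; field; rewrite gt_eqF.
Qed.

End poisson_binomial.

(** * Stein's equation for the Gaussian law *)

Section derivatives.
Context {R : realType}.
Implicit Types (f g : R -> R) (x df dg : R).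

Lemma is_derive1M {f g x df dg} : is_derive x 1 f df -> is_derive x 1 g dg ->
  is_derive x 1 (fun y => f y * g y) (df * g x + f x * dg).
Proof.
move=> hf hg; have := is_deriveM hf hg.
by rewrite addrC /GRing.scale/= [g x * _]mulrC.
Qed.

Lemma is_derive1D {f g x df dg} : is_derive x 1 f df -> is_derive x 1 g dg ->
  is_derive x 1 (fun y => f y + g y) (df + dg).
Proof. by move=> hf hg; exact: is_deriveD. Qed.

Lemma is_derive1V {f x df} : f x != 0 -> is_derive x 1 f df ->
  is_derive x 1 (fun y => (f y)^-1) (- (f x) ^- 2 * df).
Proof. by move=> fx hf; exact: is_deriveV. Qed.

Lemma is_derive1_chain {f g x df dg} : is_derive (g x) 1 f df ->
  is_derive x 1 g dg -> is_derive x 1 (fun y => f (g y)) (df * dg).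
Proof. by move=> hf hg; exact: is_derive1_comp. Qed.

Lemma is_derive1_id x : is_derive x 1 (fun y : R => y) 1.
Proof. exact: is_derive_id. Qed.

Lemma is_derive1_cst (k x : R) : is_derive x 1 (fun _ : R => k) 0.
Proof. exact: is_derive_cst. Qed.

Lemma MVT_is_derive {f} {df : R -> R} {a b} : a <= b ->
  (forall x, a <= x <= b -> is_derive x 1 f (df x)) ->
  exists2 c, a <= c <= b & f b - f a = df c * (b - a).
Proof.
rewrite le_eqVlt => /predU1P[->|ab] h.
  by exists b; rewrite ?lexx// !subrr mulr0.
have h' x : x \in `]a, b[ -> is_derive x 1 f (df x).
  by rewrite in_itv/= => /andP[ax xb]; apply: h; rewrite !ltW.
have cf : {within `[a, b], continuous f}.
  apply: derivable_within_continuous => x; rewrite in_itv/= => xab.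
  by have [] := h x xab.
have [c cab ->] := MVT ab h' cf; exists c => //.
by move: cab; rewrite in_itv/= => /andP[ac cb]; rewrite !ltW.
Qed.

Lemma is_derive_ge0_le {f} {df : R -> R} {a b} : a <= b ->
  (forall x, a <= x <= b -> is_derive x 1 f (df x)) ->
  (forall x, a <= x <= b -> 0 <= df x) -> f a <= f b.
Proof.
move=> ab h h0; have [c cab e] := MVT_is_derive ab h.
by rewrite -subr_ge0 e mulr_ge0 ?h0// subr_ge0.
Qed.

End derivatives.

(** * Mills' inequalities for the Gaussian tail *)

Section gaussian_tail.
Context {R : realType} (c : R) (c0 : 0 < c).

(** Any positive [c] is allowed; the normalisation is carried by the hypotheses on [Phi]. *)
Definition gauss_pdf (w : R) : R := c * expR (- (w ^+ 2 / 2)).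
Definition gauss_pdfV (w : R) : R := c^-1 * expR (w ^+ 2 / 2).
Local Notation phi := gauss_pdf.
Local Notation psi := gauss_pdfV.

Lemma gauss_pdf_gt0 w : 0 < phi w.
Proof. by rewrite mulr_gt0// expR_gt0. Qed.

Lemma gauss_pdfV_gt0 w : 0 < psi w.
Proof. by rewrite mulr_gt0 ?invr_gt0// expR_gt0. Qed.

Lemma gauss_pdf_le w : phi w <= c.
Proof.
by rewrite ler_piMr ?(ltW c0)// -expR0 ler_expR oppr_le0 divr_ge0// sqr_ge0.
Qed.

Lemma gauss_pdfK w : phi w * psi w = 1.
Proof. by rewrite mulrACA -expRD addNr expR0 mulr1 divff// gt_eqF. Qed.

Lemma gauss_pdfN w : phi (- w) = phi w.
Proof. by rewrite /phi sqrrN. Qed.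

Lemma gauss_pdfVN w : psi (- w) = psi w.
Proof. by rewrite /psi sqrrN. Qed.

Let is_derive_sqr2 (x : R) : is_derive x 1 (fun w => w ^+ 2 / 2) x.
Proof.
have d := is_derive1M (is_derive1M (is_derive1_id x) (is_derive1_id x))
  (is_derive1_cst 2^-1 x).
by apply: is_derive_eq d _; field.
Qed.

Lemma is_derive_gauss_pdf (x : R) : is_derive x 1 phi (- x * phi x).
Proof.
have d := is_derive1M (is_derive1_cst c x) (is_derive1_chain
   (g := fun w => -1 * (w ^+ 2 / 2)) (is_derive_expR _)
   (is_derive1M (is_derive1_cst (-1) x) (is_derive_sqr2 x))).
rewrite (_ : phi = fun w => c * expR (-1 * (w ^+ 2 / 2))); last first.
  by apply/funext => w; rewrite mulN1r.
apply: is_derive_eq d _; rewrite !mulN1r; ring.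
Qed.

Lemma is_derive_gauss_pdfV (x : R) : is_derive x 1 psi (x * psi x).
Proof.
have d := is_derive1M (is_derive1_cst c^-1 x) (is_derive1_chain
   (g := fun w => w ^+ 2 / 2) (is_derive_expR _) (is_derive_sqr2 x)).
by apply: is_derive_eq d _; rewrite /psi; ring.
Qed.

Section left_tail.
Context (Phi : R -> R).
Hypothesis dPhi : forall x : R, is_derive x 1 Phi (phi x).
Hypothesis Phi_ge0 : forall x, 0 <= Phi x.
Hypothesis Phi_cvg0 : forall w e, 0 < e -> exists2 v, v < w & Phi v < e.

(** On the negative axis [Phi u + phi u / u] has derivative [- phi u / u ^+ 2], hence decreases, and
    far to the left it is below any [e > 0]. *)
Lemma gauss_tail_le w : w < 0 -> - w * Phi w <= phi w.
Proof.
move=> w0; rewrite -subr_ge0.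
suff : Phi w + phi w / w <= 0.
  rewrite -(pmulr_rle0 _ (_ : 0 < - w)) ?oppr_gt0// => h.
  rewrite -oppr_le0; apply: le_trans h; rewrite le_eqVlt; apply/orP; left.
  by apply/eqP; field; rewrite lt_eqF.
apply/ler_addgt0Pl => e e0; rewrite addr0.
have [v vw ve] := Phi_cvg0 w e e0.
have v0 := lt_trans vw w0.
apply: (@le_trans _ _ (Phi v + phi v / v)); last first.
  apply: le_trans (ltW ve); rewrite gerDl pmulr_rle0 ?gauss_pdf_gt0//.
  by rewrite invr_le0 ltW.
rewrite -lerN2 -[leLHS]mulN1r -[leRHS]mulN1r.
pose k u := -1 * (Phi u + phi u / u).
have dk x : v <= x <= w -> is_derive x 1 k (phi x / x ^+ 2).
  move=> /andP[vx xw]; have x0 : x != 0 by rewrite lt_eqF// (le_lt_trans xw).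
  have d := is_derive1M (is_derive1_cst (-1) x) (is_derive1D (dPhi x)
    (is_derive1M (is_derive_gauss_pdf x) (is_derive1V x0 (is_derive1_id x)))).
  by apply: is_derive_eq d _; field.
apply: (is_derive_ge0_le (ltW vw) dk) => x _.
by rewrite divr_ge0 ?sqr_ge0// ltW// gauss_pdf_gt0.
Qed.

(** [Phi u + u * phi u / (1 + u ^+ 2)] has derivative [2 * phi u / (1 + u ^+ 2) ^+ 2], hence
    increases, and far to the left it is above any negative number. *)
Lemma gauss_tail_ge w : 0 <= (1 + w ^+ 2) * Phi w + w * phi w.
Proof.
have s0 x : 0 < 1 + x ^+ 2 :> R by rewrite ltr_pwDl// sqr_ge0.
suff : 0 <= Phi w + w * phi w / (1 + w ^+ 2).
  rewrite -(pmulr_rge0 _ (s0 w)) => h; apply: le_trans h _.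
  rewrite le_eqVlt; apply/orP; left.
  by apply/eqP; field; rewrite gt_eqF.
apply/ler_addgt0Pl => e e0.
(* From [- v >= c / e] follows [- v * c <= e * v ^+ 2], so the rational term at [v] is at least
   [- e]. *)
pose v := Num.min (w - 1) (- (c / e)).
have vw : v < w by rewrite gt_min ltrBlDr ltrDl ltr01.
have ve : v <= - (c / e) by rewrite ge_min lexx orbT.
have v0 : v < 0 by rewrite (le_lt_trans ve)// oppr_lt0 divr_gt0.
rewrite -lerBlDl sub0r.
apply: (@le_trans _ _ (Phi v + v * phi v / (1 + v ^+ 2))).
  apply: (@le_trans _ _ (v * phi v / (1 + v ^+ 2))); last by rewrite lerDr.
  rewrite ler_pdivlMr// mulNr lerNl -mulNr.
  apply: (@le_trans _ _ (- v * c)).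
    by rewrite ler_wpM2l ?gauss_pdf_le// oppr_ge0 ltW.
  apply: (@le_trans _ _ (e * v ^+ 2)).
    rewrite -subr_ge0 (_ : _ - _ = - v * (e * - v - c)); last by ring.
    by rewrite mulr_ge0 ?oppr_ge0 ?(ltW v0)// subr_ge0 -ler_pdivrMl// mulrC lerNr.
  by rewrite ler_wpM2l ?(ltW e0)// lerDr.
pose k u := Phi u + u * phi u / (1 + u ^+ 2).
have dk x : v <= x <= w -> is_derive x 1 k (2 * phi x / (1 + x ^+ 2) ^+ 2).
  move=> _; have x0 : 1 + x * x != 0 by rewrite -expr2 gt_eqF.
  have d := is_derive1D (dPhi x) (is_derive1M
    (is_derive1M (is_derive1_id x) (is_derive_gauss_pdf x))
    (is_derive1V (f := fun y => 1 + y * y) x0 (is_derive1D (is_derive1_cst 1 x)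
      (is_derive1M (is_derive1_id x) (is_derive1_id x))))).
  by apply: is_derive_eq d _; field.
apply: (is_derive_ge0_le (ltW vw) dk) => x _.
by rewrite divr_ge0 ?sqr_ge0// mulr_ge0// ltW// gauss_pdf_gt0.
Qed.

(** The derivative is [psi] times the quantity that [gauss_tail_ge] shows to be nonnegative. *)
Lemma gauss_mills_nd x y : x <= y -> x * (Phi x * psi x) <= y * (Phi y * psi y).
Proof.
pose k u := u * (Phi u * psi u) => xy.
have dk z : x <= z <= y ->
    is_derive z 1 k (psi z * ((1 + z ^+ 2) * Phi z + z * phi z)).
  have d := is_derive1M (is_derive1_id z) (is_derive1M (dPhi z)
     (is_derive_gauss_pdfV z)).
  by move=> _; apply: is_derive_eq d _; ring.
apply: (is_derive_ge0_le xy dk) => z _.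
by rewrite mulr_ge0 ?gauss_tail_ge// ltW// gauss_pdfV_gt0.
Qed.

Lemma gauss_mills_geN1 x : -1 <= x * (Phi x * psi x).
Proof.
have [x0|x0] := leP 0 x.
  apply: (@le_trans _ _ 0); first exact: lerN10.
  by rewrite mulr_ge0// mulr_ge0// ltW// gauss_pdfV_gt0.
rewrite lerNl -(gauss_pdfK x) mulrA -mulNr ler_wpM2r ?(ltW (gauss_pdfV_gt0 _))//.
by rewrite -mulNr gauss_tail_le.
Qed.

End left_tail.
End gaussian_tail.

(** * The bounded solution of Stein's equation for a half-line *)

Section stein_solution.
Context {R : realType} (c : R) (c0 : 0 < c) (Phi : R -> R).
Local Notation phi := (gauss_pdf c).
Local Notation psi := (gauss_pdfV c).
Hypothesis dPhi : forall x : R, is_derive x 1 Phi (phi x).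
Hypothesis Phi01 : forall x, 0 <= Phi x <= 1.
Hypothesis Phi_cvg0 : forall w e, 0 < e -> exists2 v, v < w & Phi v < e.
Hypothesis Phi_cvg1 : forall w e, 0 < e -> exists2 v, w < v & 1 - e < Phi v.

Let Phi0 x : 0 <= Phi x. Proof. by case/andP: (Phi01 x). Qed.
Let Phi1 x : 0 <= 1 - Phi x. Proof. by rewrite subr_ge0; case/andP: (Phi01 x). Qed.

(** Reflection exchanges the tails: the left-tail estimates hold for [Phi'] as well, and give those
    for [1 - Phi]. *)
Let Phi' w := 1 - Phi (- w).

Let dPhi' x : is_derive x (1 : R) Phi' (phi x).
Proof.
have d := is_derive1D (is_derive1_cst 1 x) (is_derive1M (is_derive1_cst (-1) x)
  (is_derive1_chain (g := fun w => -1 * w) (dPhi _)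
     (is_derive1M (is_derive1_cst (-1) x) (is_derive1_id x)))).
rewrite (_ : Phi' = fun y => 1 + -1 * Phi (-1 * y)); last first.
  by apply/funext => w; rewrite /Phi' !mulN1r.
by apply: is_derive_eq d _; rewrite !mulN1r gauss_pdfN; ring.
Qed.

Let Phi'_cvg0 w e : 0 < e -> exists2 v, v < w & Phi' v < e.
Proof.
move=> e0; have [v wv ve] := Phi_cvg1 (- w) e e0.
exists (- v); first by rewrite ltrNl.
by rewrite /Phi' opprK ltrBlDr addrC -ltrBlDr.
Qed.

Let Phi'_ge0 w : 0 <= Phi' w. Proof. exact: Phi1. Qed.

(** Up to the factors [1 - Phi a] and [Phi a], [lower] and [upper] are [w * stein_sol w] on the two
    sides of [a]. *)
Let lower w := w * (Phi w * psi w).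
Let upper w := w * ((1 - Phi w) * psi w).

Let lower_nd x y : x <= y -> lower x <= lower y.
Proof. exact: (gauss_mills_nd c c0 Phi dPhi Phi0). Qed.

Let lower_ge x : -1 <= lower x.
Proof. exact: (gauss_mills_geN1 c c0 Phi dPhi Phi0 Phi_cvg0). Qed.

Let upperN x : upper x = - ((- x) * (Phi' (- x) * psi (- x))).
Proof. by rewrite /Phi' opprK gauss_pdfVN mulNr opprK. Qed.

Let upper_nd x y : x <= y -> upper x <= upper y.
Proof.
move=> xy; rewrite !upperN lerN2; apply: (gauss_mills_nd c c0 Phi' dPhi' Phi'_ge0).
by rewrite lerN2.
Qed.

Let upper_le x : upper x <= 1.
Proof.
rewrite upperN lerNl; exact: (gauss_mills_geN1 c c0 Phi' dPhi' Phi'_ge0 Phi'_cvg0).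
Qed.

Context (a : R).

(* Solution of [f' w - w * f w = 1_(w <= a) - Phi a] away from [a]. *)
Definition stein_sol (w : R) : R :=
  if w <= a then (1 - Phi a) * (Phi w * psi w)
  else Phi a * ((1 - Phi w) * psi w).

Local Notation f := stein_sol.
Let below (w : R) : R := (w <= a)%R%:R.

Let f1 w := (1 - Phi a) * (Phi w * psi w).
Let f2 w := Phi a * ((1 - Phi w) * psi w).

Let f1E w : w <= a -> f w = f1 w. Proof. by rewrite /f => ->. Qed.
(** The two branches agree at [a], so the second formula holds there too. *)
Let f2E w : a <= w -> f w = f2 w.
Proof.
rewrite le_eqVlt => /predU1P[<-|]; last by rewrite ltNge /f => /negbTE ->.
by rewrite /f lexx /f2; ring.
Qed.

Let gE1 w : w <= a -> w * f w = (1 - Phi a) * lower w.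
Proof. by move=> wa; rewrite f1E// mulrCA. Qed.
Let gE2 w : a <= w -> w * f w = Phi a * upper w.
Proof. by move=> wa; rewrite f2E// mulrCA. Qed.

(** On either side of [a] this is a nonnegative multiple of [lower] or [upper], both nondecreasing;
    the sides are joined at [a]. *)
Lemma stein_sol_nd x y : x <= y -> x * f x <= y * f y.
Proof.
move=> xy; have [ya|ay] := leP y a.
  by rewrite !gE1 ?(le_trans xy)// ler_wpM2l// lower_nd.
have [ax|xa] := leP a x.
  by rewrite !gE2 ?(le_trans ax)// ler_wpM2l// upper_nd.
apply: (@le_trans _ _ (a * f a)).
  by rewrite !gE1 ?(ltW xa)// ler_wpM2l// lower_nd// ltW.
by rewrite !gE2 ?(ltW ay)// ler_wpM2l// upper_nd// ltW.
Qed.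

(** The bound [lower >= -1] serves to the left of [a] and [upper <= 1] to the right; monotonicity
    carries each across [a], whence the minimum and maximum with [a]. *)
Lemma stein_sol_le1 x : `|x * f x| <= 1.
Proof.
have lo : -1 <= (1 - Phi a) * lower (Num.min x a).
  have := ler_wpM2l (Phi1 a) (lower_ge (Num.min x a)).
  by move/(le_trans _); apply; have := Phi0 a; lra.
have hi : Phi a * upper (Num.max x a) <= 1.
  apply: le_trans (ler_wpM2l (Phi0 a) (upper_le (Num.max x a))) _.
  by have := Phi1 a; lra.
rewrite ler_norml; apply/andP; split.
  apply: (le_trans lo); rewrite -gE1 ?ge_min ?lexx ?orbT//.
  by apply: stein_sol_nd; rewrite ge_min lexx.
apply: le_trans hi; rewrite -gE2 ?le_max ?lexx ?orbT//.
by apply: stein_sol_nd; rewrite le_max lexx.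
Qed.

Let df1 x : is_derive x (1 : R) f1 (x * f1 x + 1 - Phi a).
Proof.
have d := is_derive1M (is_derive1_cst (1 - Phi a) x)
  (is_derive1M (dPhi x) (is_derive_gauss_pdfV c x)).
apply: is_derive_eq d _; rewrite gauss_pdfK// /f1; ring.
Qed.

Let df2 x : is_derive x (1 : R) f2 (x * f2 x - Phi a).
Proof.
have d := is_derive1M (is_derive1_cst (Phi a) x)
  (is_derive1M (is_derive1D (is_derive1_cst 1 x)
     (is_derive1M (is_derive1_cst (-1) x) (dPhi x))) (is_derive_gauss_pdfV c x)).
rewrite (_ : f2 = fun w => Phi a * ((1 + -1 * Phi w) * psi w)); last first.
  by apply/funext => w; rewrite /f2 mulN1r.
apply: is_derive_eq d _; have := gauss_pdfK c c0 x.
by rewrite mulrDr mulrDl => e; ring: e.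
Qed.

(** Mean value theorem: the derivative at the intermediate point is controlled by its endpoint
    values, since [w * f w] is nondecreasing. *)
Let stein_sol_incr1 x y : x <= y -> y <= a ->
  (y - x) * (x * f x + 1 - Phi a) <= f y - f x
    <= (y - x) * (y * f y + 1 - Phi a).
Proof.
move=> xy ya; have [z /andP[xz zy] e] := MVT_is_derive xy (fun x _ => df1 x).
rewrite (f1E _ ya) (f1E _ (le_trans xy ya)) e -(f1E _ (le_trans zy ya)).
rewrite -(f1E _ ya) -(f1E _ (le_trans xy ya)) [_ * (y - x)]mulrC.
by rewrite !ler_wpM2l ?subr_ge0// !lerD2r stein_sol_nd.
Qed.

Let stein_sol_incr2 x y : x <= y -> a <= x ->
  (y - x) * (x * f x - Phi a) <= f y - f x <= (y - x) * (y * f y - Phi a).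
Proof.
move=> xy ax; have [z /andP[xz zy] e] := MVT_is_derive xy (fun x _ => df2 x).
rewrite (f2E _ ax) (f2E _ (le_trans ax xy)) e -(f2E _ (le_trans ax xz)).
rewrite -(f2E _ ax) -(f2E _ (le_trans ax xy)) [_ * (y - x)]mulrC.
by rewrite !ler_wpM2l ?subr_ge0// !lerD2r stein_sol_nd.
Qed.

(** The indicator is nonincreasing, so [below y] and [below x] are its extreme values on the cell
    and bound the derivative from either side. *)
Lemma stein_sol_incr x y : x < y ->
  (y - x) * (x * f x + below y - Phi a) <= f y - f x
    <= (y - x) * (y * f y + below x - Phi a).
Proof.
move=> xy; rewrite /below; have [ya|ay] := leP y a.
  by rewrite (le_trans (ltW xy) ya) stein_sol_incr1// ltW.
have [xa|ax] := leP x a; last by rewrite !addr0 stein_sol_incr2// ltW.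
rewrite addr0 (_ : true%:R = 1 :> R)//.
(* When [a] falls in the cell, the increments over [[x, a]] and [[a, y]] are bounded separately and
   added. *)
have /andP[l1 u1] := stein_sol_incr1 _ _ xa (lexx a).
have /andP[l2 u2] := stein_sol_incr2 _ _ (ltW ay) (lexx a).
have g1 := stein_sol_nd _ _ xa; have g2 := stein_sol_nd _ _ (ltW ay).
have ax0 : 0 <= a - x by rewrite subr_ge0.
have ya0 : 0 <= y - a by rewrite subr_ge0 ltW.
have := ler_wpM2l ax0 g1; have := ler_wpM2l ax0 g2.
have := ler_wpM2l ya0 g1; have := ler_wpM2l ya0 g2.
by move: ax0 ya0 => *; apply/andP; split; lra.
Qed.

(** The value at either endpoint and the difference quotient all lie between
    [x * f x + below y - Phi a] and [y * f y + below x - Phi a]; the length of this interval is the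
    right-hand side. *)
Lemma stein_sol_cell (x y z : R) : x < y -> z = x \/ z = y ->
  `| z * f z + below z - Phi a - (y - x)^-1 * (f y - f x) |
    <= (y * f y - below y) - (x * f x - below x).
Proof.
move=> xy zxy.
have /andP[lo hi] := stein_sol_incr _ _ xy.
have yx0 : 0 < y - x by rewrite subr_gt0.
have lo' : x * f x + below y - Phi a <= (y - x)^-1 * (f y - f x).
  by rewrite -(ler_pM2l yx0) mulrA divff ?gt_eqF// mul1r.
have hi' : (y - x)^-1 * (f y - f x) <= y * f y + below x - Phi a.
  by rewrite -(ler_pM2l yx0) mulrA divff ?gt_eqF// mul1r.
have g := stein_sol_nd _ _ (ltW xy).
have b : below y <= below x.
  rewrite /below ler_nat; have [ya|//] := leP y a.
  by rewrite (le_trans (ltW xy) ya).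
by rewrite ler_norml; case: zxy => ->; apply/andP; split; lra.
Qed.

End stein_solution.

(** * Berry-Esseen bound for finite Bernoulli sums *)

Section berry_esseen_poisson_binomial.
Context {R : realType} (c : R) (c0 : 0 < c) (Phi : R -> R).
Hypothesis dPhi : forall x : R, is_derive x 1 Phi (gauss_pdf c x).
Hypothesis Phi01 : forall x, 0 <= Phi x <= 1.
Hypothesis Phi_cvg0 : forall w e, 0 < e -> exists2 v, v < w & Phi v < e.
Hypothesis Phi_cvg1 : forall w e, 0 < e -> exists2 v, w < v & 1 - e < Phi v.

(** The standardised lattice has mesh [1 / sd], and its consecutive points form the cells of
    [stein_sol_cell]. That estimate is two-sided, so [pb_stein_le] applies to [f] and to [- f] with
    the same [b]. *)
Lemma poisson_binomial_berry_esseen (s : seq R) (t : R) :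
  (forall p, p \in s -> 0 <= p <= 1) -> 0 < pb_var s ->
  `|pbE s (fun j => (j%:R <= t)%R%:R) - Phi ((t - pb_mean s) / Num.sqrt (pb_var s))|
    <= 2 / Num.sqrt (pb_var s).
Proof.
move=> s01 V0; set sd := Num.sqrt _; set a := (t - _) / sd.
have sd0 : 0 < sd by rewrite sqrtr_gt0.
pose x (j : nat) := (j%:R - pb_mean s) / sd.
have xS j : x j.+1 - x j = sd^-1 by rewrite /x -natr1; field; rewrite gt_eqF.
have xlt j : x j < x j.+1 by rewrite -subr_gt0 xS invr_gt0.
have xa j : (x j <= a) = (j%:R <= t).
  by rewrite /x /a ler_pM2r ?invr_gt0// lerD2r.
pose f j := stein_sol c Phi a (x j).
pose phi j := (x j <= a)%R%:R - Phi a.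
pose b j := x j * f j - (x j <= a)%R%:R.
(* One unit comes from [stein_sol_le1], the other from the indicator. *)
have bM j : `|b j| <= 2.
  have := stein_sol_le1 c c0 Phi dPhi Phi01 Phi_cvg0 Phi_cvg1 a (x j).
  rewrite -/(f j) /b !ler_norml => /andP[l u].
  by case: (x j <= a) => /=; apply/andP; split; lra.
have cell j y : y = x j \/ y = x j.+1 ->
    `|y * stein_sol c Phi a y + (y <= a)%R%:R - Phi a - sd * (f j.+1 - f j)|
      <= b j.+1 - b j.
  move=> yx.
  have := stein_sol_cell c c0 Phi dPhi Phi01 a _ _ y (xlt j) yx.
  by rewrite xS invrK.
have cellS j y : y = x j \/ y = x j.+1 ->
    `|y * stein_sol c Phi a y + ((y <= a)%R%:R - Phi a) - sd * (f j.+1 - f j)|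
      <= b j.+1 - b j.
  by move=> /cell; rewrite addrA.
have main : pbE s phi <= 2 / sd.
  apply: (pb_stein_le s f b phi) => // j; apply: (le_trans (ler_norm _)).
    by apply: cellS; left.
  by apply: cellS; right.
have mainN : pbE s (fun j => - phi j) <= 2 / sd.
  apply: (pb_stein_le s (fun j => - f j) b) => // j.
    have := cellS j (x j) (or_introl erefl); rewrite -normrN => /(le_trans _).
    by apply; apply: le_trans (ler_norm _); rewrite le_eqVlt; apply/orP; left;
      apply/eqP; rewrite /phi /f /x -/sd; ring.
  have := cellS j (x j.+1) (or_intror erefl); rewrite -normrN => /(le_trans _).
  by apply; apply: le_trans (ler_norm _); rewrite le_eqVlt; apply/orP; left;
    apply/eqP; rewrite /phi /f /x -/sd; ring.
have e1 : pbE s phi = pbE s (fun j => (j%:R <= t)%R%:R) - Phi a.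
  have -> : phi = fun j => 1 * (j%:R <= t)%R%:R + (-1) * Phi a.
    by apply/funext => j; rewrite /phi xa; ring.
  by rewrite (pbE_lin s 1 (-1) _ (fun=> Phi a)) pbE_cst; ring.
have e2 : pbE s (fun j => - phi j) = - pbE s phi.
  have -> : (fun j => - phi j) = fun j => (-1) * phi j + 0 * 0.
    by apply/funext => j; ring.
  by rewrite (pbE_lin s (-1) 0 _ (fun=> 0)); ring.
by rewrite -e1 ler_norml lerNl -e2 mainN main.
Qed.

End berry_esseen_poisson_binomial.

(** * Series of Bernoulli variables *)

Definition bsum {R : realType} {d : measure_display} {T : measurableType d}
    (B : nat -> {mfun T >-> R}) n w : R :=
  \sum_(1 <= k < n.+1) B k w.

Section bernoulli_sum.
Context {R : realType} {d : measure_display} {T : measurableType d}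
  (P : probability T R) (B : nat -> {RV P >-> R}) (p : nat -> R).
Hypothesis indepB : mutually_independent P [set k | (1 <= k)%N] B.
Hypothesis bernB : forall k, (1 <= k)%N -> is_bernoulli P (p k) (B k).

(** The highest index comes first, so that the head is the parameter of the term split off by
    [bsumS]; indices start at 1, as in the series. *)
Fixpoint params n : seq R := if n is n'.+1 then p n'.+1 :: params n' else [::].

Lemma bsumS n w : bsum B n.+1 w = bsum B n w + B n.+1 w.
Proof. by rewrite /bsum big_nat_recr. Qed.

Lemma measurable_bsum_le n t : measurable [set w | bsum B n w <= t].
Proof.
rewrite -[X in measurable X]setTI.
have : measurable_fun setT (bsum B n) by exact: measurable_sum.
by move=> /(_ measurableT _ (measurable_itv `]-oo, t])); rewrite set_itvE.
Qed.

Let mB k (A : set R) : measurable A -> measurable (B k @^-1` A).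
Proof. by move=> mA; rewrite -[X in measurable X]setTI; exact: measurable_funPT. Qed.

Lemma bernoulli_ae01 k : (1 <= k)%N ->
  P (~` (B k @^-1` [set 0%R] `|` B k @^-1` [set 1%R])) = 0%E.
Proof.
move=> k1; have [b1 b0] := bernB k k1.
rewrite probability_setC; last by apply: measurableU; exact: mB.
have -> : P (B k @^-1` [set 0%R] `|` B k @^-1` [set 1%R]) =
    (P (B k @^-1` [set 0%R]) + P (B k @^-1` [set 1%R]))%E.
  apply: measureU; [exact: mB|exact: mB|].
  by apply/seteqP; split => // w /= [-> /eqP]; rewrite eq_sym oner_eq0.
by rewrite b0 b1 -!EFinD; congr EFin; ring.
Qed.

Let prob_split k (E : set T) : (1 <= k)%N -> measurable E ->
  P E = (P (E `&` B k @^-1` [set 0%R]) + P (E `&` B k @^-1` [set 1%R]))%E.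
Proof.
move=> k1 mE; pose Z := B k @^-1` [set 0%R] `|` B k @^-1` [set 1%R].
have mZ : measurable Z by apply: measurableU; exact: mB.
rewrite -measureU; [|by apply: measurableI => //; exact: mB
  |by apply: measurableI => //; exact: mB|]; last first.
  apply/seteqP; split => // w /= [[_ ->] [_ /eqP]].
  by rewrite eq_sym oner_eq0.
rewrite -setIUr -/Z (measureDI P mE mZ) [X in (X + _)%E](_ : _ = 0%E) ?add0e//.
apply: subset_measure0 (bernoulli_ae01 k k1).
- exact: measurableD.
- exact: measurableC.
- by move=> w [].
Qed.

(* The conditioning on later variables makes the induction on [n] go through. *)
Lemma prob_bsum_le_cond n (J : {fset nat}) (A : nat -> set R) t :
  (forall j, j \in J -> (n < j)%N) ->
  (forall j, j \in J -> measurable (A j)) ->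
  P ([set w | bsum B n w <= t] `&` \bigcap_(i in [set` J]) (B i @^-1` A i)) =
  ((pbE (params n) (fun j => (j%:R <= t)%R%:R))%:E *
    P (\bigcap_(i in [set` J]) (B i @^-1` A i)))%E.
Proof.
elim: n J A t => [|n IH] J A t nJ mA.
  have -> : [set w | bsum B 0 w <= t] = if 0 <= t then setT else set0.
    by apply/seteqP; split => w /=; rewrite /bsum big_geq//; case: ifP.
  by rewrite /=; case: ifP => _; rewrite ?setTI ?mul1e// set0I measure0 mul0e.
set K := \bigcap_(i in _) _.
have mK : measurable K.
  by apply: fin_bigcap_measurable => // i /= iJ; apply: mB; exact: mA.
(* Where [B n.+1] equals [v], the threshold for [bsum B n] is [t - v]; the index [n.+1] joins the
   conditioning family with the set [[set v]]. *)
have aux v : P ([set w | bsum B n.+1 w <= t] `&` K `&` B n.+1 @^-1` [set v]) =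
    ((pbE (params n) (fun j => (j%:R <= t - v)%R%:R))%:E *
      (P (B n.+1 @^-1` [set v]) * P K))%E.
  pose A' i := if i == n.+1 then [set v] else A i.
  pose J' : {fset nat} := (n.+1 |` J)%fset.
  have nJ' : n.+1 \notin J by apply/negP => /nJ; rewrite ltnn.
  have A'E j : j \in J -> A' j = A j.
    by move=> jJ; rewrite /A'; case: eqP => // jn; rewrite -jn jJ in nJ'.
  have mA' j : j \in J' -> measurable (A' j).
    rewrite in_fset1U => /predU1P[->|jJ]; first by rewrite /A' eqxx.
    by rewrite A'E//; exact: mA.
  have KE : K `&` B n.+1 @^-1` [set v] = \bigcap_(i in [set` J']) (B i @^-1` A' i).
    apply/seteqP; split => [w [Kw Bw] i /=|w h].
      rewrite in_fset1U => /predU1P[->|iJ]; first by rewrite /A' eqxx.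
      by rewrite A'E//; exact: Kw.
    split => [i /= iJ|].
      by have := h i; rewrite /= A'E//; apply; rewrite in_fset1U iJ orbT.
    by have := h n.+1; rewrite /= /A' eqxx; apply; rewrite in_fset1U eqxx.
  have PKE : P (K `&` B n.+1 @^-1` [set v]) = (P (B n.+1 @^-1` [set v]) * P K)%E.
    rewrite KE indepB//; last first.
      move=> i /=; rewrite in_fset1U => /predU1P[->//|/nJ].
      exact: leq_ltn_trans.
    rewrite big_fsetU1//= {1}/A' eqxx; congr (_ * _)%E.
    rewrite /K indepB//; last by move=> i /= /nJ; exact: leq_ltn_trans.
    by rewrite big_seq [RHS]big_seq; apply: eq_bigr => i iJ; rewrite A'E.
  rewrite -PKE KE -IH//; last first.
    by move=> j; rewrite in_fset1U => /predU1P[->//|/nJ/ltnW].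
  rewrite -KE -setIA; congr (P _); apply/seteqP; split => w /= [h [Kw Bw]];
    by split => //; move: h; rewrite bsumS Bw lerBrDr.
have [b1 b0] := bernB n.+1 isT.
pose E := [set w | bsum B n.+1 w <= t] `&` K.
transitivity (P (E `&` B n.+1 @^-1` [set 0%R]) +
    P (E `&` B n.+1 @^-1` [set 1%R]))%E.
  apply: prob_split => //; apply: measurableI => //.
  exact: measurable_bsum_le.
rewrite !aux b0 b1 subr0 /=.
have -> : pbE (params n) ((fun j => (j%:R <= t)%R%:R) \o S) =
          pbE (params n) (fun j => (j%:R <= t - 1)%R%:R).
  by congr pbE; apply/funext => j /=; rewrite -natr1 lerBrDr.
rewrite -(fineK (fin_num_measure P K mK)) -!EFinM -EFinD; congr EFin.
by ring.
Qed.

Lemma prob_bsum_le n t :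
  P [set w | bsum B n w <= t] = (pbE (params n) (fun j => (j%:R <= t)%R%:R))%:E.
Proof.
have := @prob_bsum_le_cond n fset0 (fun=> setT) t.
rewrite set_fset0 bigcap_set0 setIT probability_setT mule1; apply => j.
  by rewrite in_fset0.
by rewrite in_fset0.
Qed.

End bernoulli_sum.

(** * Passage from partial sums to the series *)

Section summable_bernoulli.
Context {R : realType} {d : measure_display} {T : measurableType d}
  (P : probability T R) (B : nat -> {RV P >-> R}) (p : nat -> R).
Hypothesis indepB : mutually_independent P [set k | (1 <= k)%N] B.
Hypothesis bernB : forall k, (1 <= k)%N -> is_bernoulli P (p k) (B k).
Context (m v : R).
Hypothesis mean_cvg : pb_mean (params p n) @[n --> \oo] --> m.
Hypothesis var_cvg : pb_var (params p n) @[n --> \oo] --> v.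

Let mB k (A : set R) : measurable A -> measurable (B k @^-1` A).
Proof. by move=> mA; rewrite -[X in measurable X]setTI; exact: measurable_funPT. Qed.

Let p_ge0 k : (1 <= k)%N -> 0 <= p k.
Proof. by move=> /bernB[b1 _]; rewrite -lee_fin -b1 measure_ge0. Qed.

Let p_le1 k : (1 <= k)%N -> p k <= 1.
Proof.
by move=> /bernB[b1 _]; rewrite -lee_fin -b1; apply: probability_le1; exact: mB.
Qed.

Lemma params01 n q : q \in params p n -> 0 <= q <= 1.
Proof.
elim: n => [//|n IH]; rewrite inE => /predU1P[->|//].
by rewrite p_ge0// p_le1.
Qed.

Let mean_S n : pb_mean (params p n.+1) = p n.+1 + pb_mean (params p n).
Proof. by rewrite /pb_mean big_cons. Qed.

Let var_S n : pb_var (params p n.+1) =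
  p n.+1 * (1 - p n.+1) + pb_var (params p n).
Proof. by rewrite /pb_var big_cons. Qed.

Let mean_nd : nondecreasing_seq (fun n => pb_mean (params p n)).
Proof. by apply/nondecreasing_seqP => n; rewrite mean_S lerDr p_ge0. Qed.

Let mean_le n : pb_mean (params p n) <= m.
Proof.
rewrite -(cvg_lim _ mean_cvg)//; apply: nondecreasing_cvgn_le => //.
by apply/cvg_ex; exists m.
Qed.

(** Off this event the series equals its [n]-th partial sum. *)
Let bad n : set T := \bigcup_i ~` (B (n + i).+1 @^-1` [set 0]).

Let mbad n : measurable (bad n).
Proof. by apply: bigcupT_measurable => i; apply: measurableC; exact: mB. Qed.

(** Union bound: the terms after the [n]-th are nonzero with probabilities [p k], which add up to
    the tail of the mean. *)
Let bad_le n : (P (bad n) <= (m - pb_mean (params p n))%:E)%E.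
Proof.
apply: (@le_trans _ _ (\sum_(i <oo) P (~` (B (n + i).+1 @^-1` [set 0%R])))%E).
  apply: generalized_Boole_inequality => [i|]; last exact: mbad.
  by apply: measurableC; exact: mB.
apply: lime_le; first by apply: is_cvg_nneseries => i _ _; exact: measure_ge0.
apply: nearW => N.
have -> : (\sum_(0 <= i < N) P (~` (B (n + i).+1 @^-1` [set 0%R])) =
   (pb_mean (params p (n + N)) - pb_mean (params p n))%:E)%E.
  elim: N => [|N IH]; first by rewrite big_geq// addn0 subrr.
  rewrite big_nat_recr//= IH probability_setC; last exact: mB.
  have [_ ->] := bernB (n + N).+1 isT.
  by rewrite addnS mean_S -!EFinD; congr EFin; ring.
by rewrite lee_fin lerB.
Qed.

Let bsum_notbad n w : ~ bad n w -> bsum B ^~ w @ \oo --> bsum B n w.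
Proof.
move=> nb; apply: cvg_near_cst; exists n => // N /= nN.
rewrite -(subnKC nN); elim: (N - n)%N => [|i IH]; first by rewrite addn0.
rewrite addnS bsumS IH.
suff -> : B (n + i).+1 w = 0 by rewrite addr0.
by apply: contrapT => Bw; apply: nb; exists i.
Qed.

(** The partial sums are eventually constant here, so [limn] is a true limit and not its default
    value. *)
Let Z_notbad n w : ~ bad n w -> sum_RV B w = bsum B n w.
Proof. by move=> /bsum_notbad; exact: cvg_lim. Qed.

Let measurable_sum_le t : measurable [set w | sum_RV B w <= t].
Proof.
rewrite -[X in measurable X]setTI.
by have := measurable_sum_RV B measurableT (measurable_itv `]-oo, t]); rewrite set_itvE.
Qed.

(** The two events differ only inside [bad n]. *)
Let prob_sum_RV_bsum n t :
  `| fine (P [set w | sum_RV B w <= t]) - fine (P [set w | bsum B n w <= t]) |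
  <= m - pb_mean (params p n).
Proof.
set A := [set w | _]; set A' := [set w | _].
have mA : measurable A by exact: measurable_sum_le.
have mA' : measurable A' by exact: measurable_bsum_le.
have fP (X : set T) : measurable X -> (fine (P X))%:E = P X.
  by move=> mX; rewrite fineK// fin_num_measure.
have aux (X Y : set T) : measurable X -> measurable Y -> X `<=` Y `|` bad n ->
    fine (P X) <= fine (P Y) + (m - pb_mean (params p n)).
  move=> mX mY XY; rewrite -lee_fin EFinD !fP//.
  apply: le_trans (leeD2l _ (bad_le n)).
  apply: le_trans (measureU2 _ mY (mbad n)).
  by apply: le_measure => //; rewrite inE//; exact: measurableU.
have h1 : A `<=` A' `|` bad n.
  move=> w Aw; have [bw|nbw] := pselect (bad n w); [by right|left].
  by rewrite /A' /= -(Z_notbad n).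
have h2 : A' `<=` A `|` bad n.
  move=> w Aw; have [bw|nbw] := pselect (bad n w); [by right|left].
  by rewrite /A /= (Z_notbad n).
by rewrite ler_distlC; apply/andP; split;
  rewrite ?lerBlDr; exact: aux.
Qed.

(** The finite bound for [params p n] carries over up to the truncation error [m - M n], which
    vanishes in the limit; [Phi] is continuous, so both sides converge. *)
Lemma bernoulli_series_berry_esseen (c : R) (Phi : R -> R) t : 0 < c -> 0 < v ->
  (forall x : R, is_derive x 1 Phi (gauss_pdf c x)) ->
  (forall x, 0 <= Phi x <= 1) ->
  (forall w e, 0 < e -> exists2 u, u < w & Phi u < e) ->
  (forall w e, 0 < e -> exists2 u, w < u & 1 - e < Phi u) ->
  `| fine (P [set w | sum_RV B w <= t]) - Phi ((t - m) / Num.sqrt v) |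
    <= 2 / Num.sqrt v.
Proof.
move=> c0 v0 dPhi Phi01 Phi0 Phi1.
pose M n := pb_mean (params p n); pose V n := pb_var (params p n).
have sV : Num.sqrt (V n) @[n --> \oo] --> Num.sqrt v.
  by apply: continuous_cvg var_cvg; exact: sqrt_continuous.
have sVi : (Num.sqrt (V n))^-1 @[n --> \oo] --> (Num.sqrt v)^-1.
  by apply: cvgV sV; rewrite gt_eqF// sqrtr_gt0.
have PhiV : Phi ((t - M n) / Num.sqrt (V n)) @[n --> \oo] -->
    Phi ((t - m) / Num.sqrt v).
  apply: continuous_cvg.
    apply: differentiable_continuous; apply/derivable1_diffP.
    by have [] := dPhi ((t - m) / Num.sqrt v).
  by apply: cvgM sVi; apply: cvgB mean_cvg; exact: cvg_cst.
have lhs_cvg : `|fine (P [set w | sum_RV B w <= t]) -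
      Phi ((t - M n) / Num.sqrt (V n))| @[n --> \oo] -->
    `|fine (P [set w | sum_RV B w <= t]) - Phi ((t - m) / Num.sqrt v)|.
  by apply: cvg_norm; apply: cvgB PhiV; exact: cvg_cst.
have rhs_cvg : 2 / Num.sqrt (V n) + (m - M n) @[n --> \oo] --> 2 / Num.sqrt v.
  rewrite -[X in _ --> X]addr0; apply: cvgD.
    by apply: cvgM sVi; exact: cvg_cst.
  by rewrite -(subrr m); apply: cvgB mean_cvg; exact: cvg_cst.
apply: (ler_cvg_to lhs_cvg rhs_cvg).
(* The finite bound asks for a positive variance, available for large [n] because [v] is
   positive. *)
have V0 : \forall n \near \oo, 0 < V n by exact: (cvgr_gt v).
  apply: filterS V0 => n V0.
  have := poisson_binomial_berry_esseen c c0 Phi dPhi Phi01 Phi0 Phi1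
    (params p n) t (params01 n) V0.
  have -> : pbE (params p n) (fun j => (j%:R <= t)%R%:R) =
      fine (P [set w | bsum B n w <= t]).
    by rewrite (prob_bsum_le P B p indepB bernB).
  move=> h2; rewrite [leRHS]addrC.
  apply: le_trans (lerD (prob_sum_RV_bsum n t) h2).
  exact: ler_distD.
Qed.

(** * Variance of the series *)

Let A k := B k @^-1` [set 1].
(** The indicators agree with the [B k] almost surely, and their partial sums are nonnegative and
    nondecreasing everywhere, as monotone convergence requires. *)
Let Y n w : R := \sum_(1 <= k < n.+1) \1_(A k) w.

Let mA k : measurable (A k). Proof. exact: mB. Qed.

Let YS n w : Y n.+1 w = Y n w + \1_(A n.+1) w.
Proof. by rewrite /Y big_nat_recr. Qed.

Let Y_ge0 n w : 0 <= Y n w. Proof. by rewrite /Y sumr_ge0. Qed.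

Let mY n : measurable_fun setT (Y n).
Proof. by apply: measurable_sum => k; exact: measurable_indic. Qed.

Let mI k : measurable_fun setT (\1_(A k) : T -> R).
Proof. exact: measurable_indic. Qed.

Let I_ge0 k w : 0 <= \1_(A k) w :> R. Proof. by []. Qed.

Let PA k : (1 <= k)%N -> P (A k) = (p k)%:E.
Proof. by move=> /bernB[]. Qed.

Let PAA j k : (1 <= j)%N -> (j < k)%N -> P (A j `&` A k) = (p j * p k)%:E.
Proof.
move=> j1 jk; have k1 : (1 <= k)%N by exact: leq_ltn_trans jk.
have kj : k \notin [fset j]%fset by rewrite in_fset1 gtn_eqF.
have := indepB (k |` [fset j])%fset (fun=> [set 1]).
rewrite big_fsetU1//= big_seq_fset1 -/(A j) -/(A k) !PA// -EFinM mulrC => <-//.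
- congr (P _); apply/seteqP; split => [w [Aj Ak] i /=|w h].
    by rewrite in_fset1U in_fset1 => /predU1P[->|/eqP ->].
  by split; apply: h; rewrite /= in_fset1U in_fset1 eqxx ?orbT.
- by move=> i /=; rewrite in_fset1U in_fset1 => /predU1P[->|/eqP ->].
Qed.

Let int_I k : (1 <= k)%N -> (\int[P]_w (\1_(A k) w)%:E = (p k)%:E)%E.
Proof. by move=> k1; rewrite integral_indic// setIT; exact: PA. Qed.

Let int_II j k : (1 <= j)%N -> (j < k)%N ->
  (\int[P]_w (\1_(A j `&` A k) w)%:E = (p j * p k)%:E)%E.
Proof.
move=> j1 jk; rewrite integral_indic//; last exact: measurableI.
by rewrite setIT; exact: PAA.
Qed.

Let intD (f g : T -> R) : measurable_fun setT f -> measurable_fun setT g ->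
  (forall w, 0 <= f w) -> (forall w, 0 <= g w) ->
  (\int[P]_w (f w + g w)%:E = \int[P]_w (f w)%:E + \int[P]_w (g w)%:E)%E.
Proof.
move=> mf mg f0 g0; rewrite -ge0_integralD//.
- by move=> w _; rewrite lee_fin.
- exact/measurable_EFinP.
- by move=> w _; rewrite lee_fin.
- exact/measurable_EFinP.
Qed.

Let int_Y n : (\int[P]_w (Y n w)%:E = (pb_mean (params p n))%:E)%E.
Proof.
elim: n => [|n IH].
  rewrite /Y; under eq_integral do rewrite big_geq//.
  by rewrite integral0 /pb_mean big_nil.
under eq_integral do rewrite YS.
rewrite intD ?IH//.
by rewrite int_I// mean_S -EFinD addrC.
Qed.

(** Supplies the cross terms in the second moment of [Y]. *)
Let int_Y_indic n k : (n < k)%N ->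
  (\int[P]_w (Y n w * \1_(A k) w)%:E = (pb_mean (params p n) * p k)%:E)%E.
Proof.
elim: n => [|n IH] nk.
  rewrite /Y; under eq_integral do rewrite big_geq// mul0r.
  by rewrite integral0 /pb_mean big_nil mul0r.
have e w : Y n.+1 w * \1_(A k) w = Y n w * \1_(A k) w + \1_(A n.+1 `&` A k) w.
  by rewrite YS mulrDl indicI.
under eq_integral do rewrite e.
have mYA : measurable_fun setT (fun w => Y n w * \1_(A k) w).
  exact: measurable_funM.
have mII : measurable_fun setT (\1_(A n.+1 `&` A k) : T -> R).
  by apply: measurable_indic; exact: measurableI.
have YA0 w : 0 <= Y n w * \1_(A k) w by rewrite mulr_ge0.
rewrite intD//= IH; last exact: ltnW.
by rewrite int_II// mean_S -EFinD; congr EFin; ring.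
Qed.

Let int_Y_sqr n : (\int[P]_w (Y n w ^+ 2)%:E =
  (pb_var (params p n) + pb_mean (params p n) ^+ 2)%:E)%E.
Proof.
elim: n => [|n IH].
  rewrite /Y; under eq_integral do rewrite big_geq// expr0n.
  by rewrite integral0 /pb_mean /pb_var !big_nil add0r expr0n.
(* The indicator is its own square; the double product is split into two equal nonnegative summands,
   to which [intD] applies. *)
have e w : Y n.+1 w ^+ 2 = Y n w ^+ 2 + (Y n w * \1_(A n.+1) w +
    (Y n w * \1_(A n.+1) w + \1_(A n.+1) w)).
  rewrite YS; have : \1_(A n.+1) w ^+ 2 = \1_(A n.+1) w :> R.
    by rewrite indicE; case: (_ \in _); rewrite ?expr1n ?expr0n.
  by move=> e; ring: e.
under eq_integral do rewrite e.
have mYA : measurable_fun setT (fun w => Y n w * \1_(A n.+1) w).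
  by apply: measurable_funM => //; exact: measurable_indic.
have YA0 w : 0 <= Y n w * \1_(A n.+1) w by rewrite mulr_ge0.
have mYA2 : measurable_fun setT (fun w => Y n w * \1_(A n.+1) w + \1_(A n.+1) w).
  exact: measurable_funD.
rewrite intD//; last 4 first.
- exact: measurable_funX.
- exact: measurable_funD.
- by move=> w; exact: sqr_ge0.
- by move=> w; rewrite !addr_ge0.
rewrite intD//; last by move=> w; rewrite addr_ge0.
rewrite intD// IH int_Y_indic// int_I// mean_S var_S.
by rewrite -!EFinD; congr EFin; ring.
Qed.

(** Borel-Cantelli: the intersection of the [bad n] has probability at most every tail of the mean,
    and these tails tend to 0. *)
Let ae_bad : \forall w \ae P, exists n, ~ bad n w.
Proof.
exists (\bigcap_n bad n); split.
- exact: bigcapT_measurable.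
- have mcap : measurable (\bigcap_n bad n) by exact: bigcapT_measurable.
  apply/eqP; rewrite -measure_le0 -(fineK (fin_num_measure P _ mcap)) lee_fin.
  have h : m - pb_mean (params p n) @[n --> \oo] --> 0.
    by rewrite -(subrr m); apply: cvgB mean_cvg; exact: cvg_cst.
  apply: (ler_cvg_to (cvg_cst _) h); apply: nearW => n.
  rewrite -lee_fin (fineK (fin_num_measure P _ mcap)).
  apply: le_trans (bad_le n); apply: le_measure; rewrite ?inE//.
  by move=> w; apply.
- by move=> w /= /forallNP h n _; apply: contrapT; exact: h.
Qed.

Let ae_cvg : \forall w \ae P, Y ^~ w @ \oo --> sum_RV B w.
Proof.
have h : \forall w \ae P, forall k, B k.+1 w = 0 \/ B k.+1 w = 1.
  apply: ae_foralln => k.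
  exists (~` (B k.+1 @^-1` [set 0] `|` B k.+1 @^-1` [set 1])); split.
  - by apply: measurableC; apply: measurableU; exact: mB.
  - exact: (bernoulli_ae01 P B p bernB).
  - by move=> w /=.
apply: filterS2 h ae_bad => w w01 [n nbad].
rewrite (Z_notbad _ _ nbad).
rewrite (_ : Y ^~ w = bsum B ^~ w); first exact: bsum_notbad.
apply/funext => N; elim: N => [|N IH]; first by rewrite /Y /bsum !big_geq.
rewrite YS bsumS IH; congr (_ + _); rewrite indicE.
case: (w01 N) => e; rewrite e.
  rewrite memNset//= /A/= e => /esym/eqP; by rewrite oner_eq0.
by rewrite mem_set.
Qed.

(** Monotone convergence for the powers of [Y n], whose limit is that of the series almost surely by
    [ae_cvg]. *)
Let moment k (L : nat -> R) (l : R) :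
  (forall n, \int[P]_w (Y n w ^+ k)%:E = (L n)%:E)%E ->
  L @ \oo --> l ->
  (\int[P]_w (sum_RV B w ^+ k)%:E = l%:E)%E.
Proof.
move=> intL Ll.
have mYk n : measurable_fun setT (fun w => (Y n w ^+ k)%:E).
  by apply/measurable_EFinP; exact: measurable_funX.
have Yk0 n w : setT w -> (0 <= (Y n w ^+ k)%:E)%E.
  by move=> _; rewrite lee_fin exprn_ge0.
have ndY w : setT w -> nondecreasing_seq (fun n => (Y n w ^+ k)%:E).
  move=> _; apply/nondecreasing_seqP => n.
  by rewrite lee_fin lerXn2r ?nnegrE// YS lerDl.
have := @cvg_monotone_convergence _ _ _ P setT measurableT
  (fun n w => (Y n w ^+ k)%:E) mYk Yk0 ndY.
under eq_fun do rewrite intL.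
move=> h; have : (L n)%:E @[n --> \oo] --> l%:E by apply: cvg_EFin Ll; exact: nearW.
move=> /(cvg_unique _ h) <- //.
apply: ae_eq_integral => //.
- apply/measurable_EFinP; apply: measurable_funX; exact: measurable_sum_RV.
- apply: (emeasurable_fun_cvg _ _ mYk) => w _.
  by apply: ereal_nondecreasing_is_cvgn; exact: ndY.
- apply: filterS ae_cvg => w cw _; apply/esym/cvg_lim => //.
  apply: cvg_EFin; first exact: nearW.
  exact: (continuous_cvg _ (@exprn_continuous R k (sum_RV B w)) cw).
Qed.

Lemma bernoulli_series_variance : 'V_P[sum_RV B] = v%:E.
Proof.
have E1 : (\int[P]_w (sum_RV B w)%:E = m%:E)%E.
  apply: (moment 1 (fun n => pb_mean (params p n))) => // n; exact: int_Y.
have E2 : (\int[P]_w (sum_RV B w ^+ 2)%:E = (v + m ^+ 2)%:E)%E.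
  apply: (moment 2 (fun n => pb_var (params p n) + pb_mean (params p n) ^+ 2)) => //.
  apply: cvgD => //.
  exact: (continuous_cvg _ (@exprn_continuous R 2 m) mean_cvg).
have mZ : measurable_fun setT (sum_RV B) by exact: measurable_sum_RV.
have L2 : (sum_RV B * sum_RV B)%R \in Lfun P 1.
  apply/Lfun1_integrable/integrableP; split.
    by apply/measurable_EFinP; exact: measurable_funM.
  rewrite (eq_integral (fun w => (sum_RV B w ^+ 2)%:E)) ?E2 ?ltry// => w _.
  by rewrite /= ger0_norm ?expr2// -expr2 sqr_ge0.
(* Domination by [1 + z ^+ 2], which is integrable under a probability. *)
have L1 : sum_RV B \in Lfun P 1.
  apply/Lfun1_integrable.
  apply: (@le_integrable _ _ _ P setT _ _
    (fun w => 1%:E + (sum_RV B w * sum_RV B w)%:E)%E) => //.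
  - exact/measurable_EFinP.
  - move=> w _; rewrite /= lee_fin -expr2 [leRHS]ger0_norm ?addr_ge0 ?sqr_ge0//.
    rewrite -(real_normK (num_real (sum_RV B w))).
    by have := sqr_ge0 (`|sum_RV B w| - 1); nra.
  - apply: integrableD => //; first exact: finite_measure_integrable_cst.
    exact/Lfun1_integrable.
rewrite /variance covarianceE// !unlock.
have -> : (\int[P]_w ((sum_RV B * sum_RV B)%R w)%:E)%E = (v + m ^+ 2)%:E.
  by rewrite -E2; apply: eq_integral => w _; rewrite expr2.
by rewrite E1 -EFinM -EFinB; congr EFin; ring.
Qed.

End summable_bernoulli.

(** * The standard normal distribution function *)

Section standard_normal_cdf.
Context {R : realType}.

Definition normal_cdf (t : R) : R :=
  fine (cdf (P := normal_prob 0 1) (@idTR R) t).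

Lemma normal_cdfE (t : R) :
  (normal_cdf t)%:E = cdf (P := normal_prob 0 1) (@idTR R) t.
Proof.
rewrite /normal_cdf fineK// ge0_fin_numE ?cdf_ge0//.
by rewrite (le_lt_trans (cdf_le1 _ _))// ltry.
Qed.

Lemma normal_pdf01E : normal_pdf 0 1 = gauss_pdf (normal_peak (1 : R)).
Proof.
rewrite normal_pdfE ?oner_neq0//; apply/funext => x.
by rewrite /gauss_pdf /normal_fun subr0 mulNr expr1n.
Qed.

Lemma is_derive_normal_cdf (x : R) :
  is_derive x 1 normal_cdf (gauss_pdf (normal_peak 1) x).
Proof.
have i := @integrable_normal_pdf R 0 1.
have cx : {for x, continuous (normal_pdf (0 : R) 1)}.
  by apply: continuous_normal_pdf; rewrite oner_neq0.
(* The endpoint [x + 1] gives a half-line with [x] in its interior, for the fundamental theorem of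
   calculus. *)
have ix : lebesgue_measure.-integrable `]-oo, x + 1] (EFin \o normal_pdf 0 1).
  by apply: integrableS i.
have xx1 : x < x + 1 by rewrite ltrDl ltr01.
have [dF F'] := continuous_FTC1 xx1 ix (ltNyr _) cx.
by split; [exact: dF|rewrite -derive1E -normal_pdf01E -F'].
Qed.

Lemma normal_cdf01 (x : R) : 0 <= normal_cdf x <= 1.
Proof. by rewrite -!lee_fin normal_cdfE cdf_ge0 cdf_le1. Qed.

Lemma normal_cdf_lt (w e : R) : 0 < e -> exists2 u, u < w & normal_cdf u < e.
Proof.
move=> e0.
have h : normal_cdf @ -oo --> (0 : R).
  by apply: fine_cvg; exact: cvg_cdfNy0.
have h1 : \forall u \near -oo, normal_cdf u < e by exact: (cvgr_lt 0).
have h2 : \forall u \near -oo, (u : R) < w by exact: (nbhs_ninfty_lt (num_real _)).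
by have [u [u1 u2]] := filter_ex (filterI h1 h2); exists u.
Qed.

Lemma normal_cdf_gt (w e : R) : 0 < e -> exists2 u, w < u & 1 - e < normal_cdf u.
Proof.
move=> e0.
have h : normal_cdf @ +oo --> (1 : R).
  by apply: fine_cvg; exact: cvg_cdfy1.
have h1 : \forall u \near +oo, 1 - e < normal_cdf u.
  by apply: (cvgr_gt 1) => //; rewrite ltrBlDr ltrDl.
have h2 : \forall u \near +oo, w < (u : R) by exact: (nbhs_pinfty_gt (num_real _)).
by have [u [u1 u2]] := filter_ex (filterI h1 h2); exists u.
Qed.

End standard_normal_cdf.

(** * Mean and variance for geometric parameters *)

Section geometric_parameters.
Context {R : realType} (q : R) (q01 : 0 < q < 1).

Let q1 : 1 - q != 0.
Proof. by rewrite subr_eq0 gt_eqF//; case/andP: q01. Qed.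
Let q2 : 1 - q ^+ 2 != 0.
Proof.
by case/andP: q01 => q0 ql1; rewrite subr_eq0 gt_eqF// expr_lt1// ltW.
Qed.

Lemma pb_mean_geometric n : pb_mean (params (fun k => q ^+ k) n) =
  q / (1 - q) * (1 - q ^+ n).
Proof.
rewrite /pb_mean; elim: n => [|n IH]; first by rewrite big_nil subrr mulr0.
by rewrite big_cons IH !exprS; field.
Qed.

(** Difference of geometric sums of ratios [q] and [q ^+ 2]. *)
Lemma pb_var_geometric n : pb_var (params (fun k => q ^+ k) n) =
  q / (1 - q) * (1 - q ^+ n) - q ^+ 2 / (1 - q ^+ 2) * (1 - q ^+ n * q ^+ n).
Proof.
rewrite /pb_var; elim: n => [|n IH].
  by rewrite big_nil expr0 mulr1 subrr !mulr0 subrr.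
by rewrite big_cons IH !exprS; field; rewrite q1 -expr2 q2.
Qed.

Let cvg_qn : q ^+ n @[n --> \oo] --> 0.
Proof. by apply: cvg_expr; case/andP: q01 => q0 ql1; rewrite gtr0_norm. Qed.

Lemma cvg_pb_mean_geometric :
  pb_mean (params (fun k => q ^+ k) n) @[n --> \oo] --> q / (1 - q).
Proof.
rewrite (funext pb_mean_geometric).
have c : q / (1 - q) * (1 - q ^+ n) @[n --> \oo] --> q / (1 - q) * (1 - 0).
  exact: (cvgM (cvg_cst _) (cvgB (cvg_cst _) cvg_qn)).
by move: c; rewrite subr0 mulr1.
Qed.

Lemma cvg_pb_var_geometric :
  pb_var (params (fun k => q ^+ k) n) @[n --> \oo] --> q / (1 - q ^+ 2).
Proof.
rewrite (funext pb_var_geometric).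
have e : q / (1 - q ^+ 2) =
    q / (1 - q) * (1 - 0) - q ^+ 2 / (1 - q ^+ 2) * (1 - 0 * 0).
  by field; rewrite q1 q2.
have c : q / (1 - q) * (1 - q ^+ n) -
    q ^+ 2 / (1 - q ^+ 2) * (1 - q ^+ n * q ^+ n) @[n --> \oo] -->
    q / (1 - q) * (1 - 0) - q ^+ 2 / (1 - q ^+ 2) * (1 - 0 * 0).
  exact: (cvgB (cvgM (cvg_cst _) (cvgB (cvg_cst _) cvg_qn))
    (cvgM (cvg_cst _) (cvgB (cvg_cst _) (cvgM cvg_qn cvg_qn)))).
by rewrite -e in c.
Qed.

End geometric_parameters.

Theorem mainTheorem3 (R : realType) :
  exists C h0 : R, [/\ C <= 166, 0 < h0 &
    forall (h r : R), h0 <= h -> 0 < r < 1 ->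
      h = 4 * pi * r ^+ 2 / (1 - r ^+ 2) ->
    forall (d : measure_display) (T : measurableType d) (P : probability T R)
      (B : nat -> {RV P >-> R}),
      mutually_independent P [set k | (1 <= k)%N] B ->
      (forall k, (1 <= k)%N -> is_bernoulli P (r ^+ (2 * k)) (B k)) ->
    let Z : {RV P >-> R} := sum_RV B in
    let stdZ : {RV P >-> R} :=
      shift_scale (h / (4 * pi)) (Num.sqrt (fine 'V_P[Z])) Z in
    (dKol P stdZ (normal_prob 0 1) (@idTR R) <= (C / Num.sqrt h)%:E)%E].
Proof.
(* [12 = 2 * 6]: the rate [2 / Num.sqrt v] is combined with [Num.sqrt h <= 6 * Num.sqrt v]. The
   threshold 1 gives [h > 0]. *)
exists 12, 1; split; [by rewrite ler_nat|by []|].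
move=> h r h1 /andP[r0 r1] hE d T P B indepB bernB.
pose Z : {RV P >-> R} := sum_RV B.
pose stdZ : {RV P >-> R} :=
  shift_scale (h / (4 * pi)) (Num.sqrt (fine 'V_P[Z])) Z.
change (dKol P stdZ (normal_prob 0 1) (@idTR R) <= (12 / Num.sqrt h)%:E)%E.
pose q := r ^+ 2.
have q01 : 0 < q < 1 by rewrite exprn_gt0//= expr_lt1// ltW.
have bernBq k : (1 <= k)%N -> is_bernoulli P (q ^+ k) (B k).
  by move=> k1; rewrite /q -exprM; exact: bernB.
have meanq := cvg_pb_mean_geometric q q01.
have varq := cvg_pb_var_geometric q q01.
case/andP: (q01) => q0 q1.
set v := q / (1 - q ^+ 2) in varq.
have oneBq : 0 < 1 - q by rewrite subr_gt0.
have oneDq : 0 < 1 + q by rewrite addr_gt0.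
have vE : v = q / ((1 - q) * (1 + q)).
  by rewrite /v (_ : 1 - q ^+ 2 = (1 - q) * (1 + q))//; ring.
have v0 : 0 < v by rewrite vE divr_gt0// mulr_gt0.
have varE : fine 'V_P[Z] = v.
  by rewrite (bernoulli_series_variance P B _ indepB bernBq _ _ meanq varq).
have pi0 : 0 < pi :> R by exact: pi_gt0.
have mE : h / (4 * pi) = q / (1 - q).
  rewrite hE -/q; move: pi0; generalize (@pi R) => u u0.
  by field; rewrite (gt_eqF u0) (gt_eqF oneBq).
(* With [pi <= 4] and [q < 1], the factor [4 * pi * (1 + q)] is at most 32; 36 is the next perfect
   square. *)
have hv : h <= 36 * v.
  have pi4 : pi <= 4 :> R by have := pihalf_lt2 R; lra.
  have -> : h = 4 * pi * (1 + q) * v.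
    rewrite hE -/q vE; generalize (@pi R) => u.
    by field; rewrite (gt_eqF oneDq) (gt_eqF oneBq).
  by rewrite ler_wpM2r ?(ltW v0)//; nra.
have sv0 : 0 < Num.sqrt v by rewrite sqrtr_gt0.
have h0 : 0 < h by exact: lt_le_trans h1.
have sh0 : 0 < Num.sqrt h by rewrite sqrtr_gt0.
have rate : 2 / Num.sqrt v <= 12 / Num.sqrt h.
  rewrite ler_pdivrMr// mulrAC ler_pdivlMr//.
  suff : Num.sqrt h <= 6 * Num.sqrt v by lra.
  apply: le_trans (ler_wsqrtr hv) _; rewrite sqrtrM//.
  by rewrite (_ : 36 = 6 ^+ 2) ?sqrtr_sqr ?ger0_norm//; ring.
rewrite /dKol; apply: ge_ereal_sup => _ [a _ <-].
(* Undoes the standardisation at [a]; the mean [q / (1 - q)] is [h / (4 * pi)] by [mE]. *)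
pose t := a * Num.sqrt v + q / (1 - q).
have -> : cdf stdZ a = (fine (P [set w | sum_RV B w <= t]))%:E.
  rewrite fineK; last first.
    apply: fin_num_measure; rewrite -[X in measurable X]setTI.
    have := measurable_sum_RV B measurableT (measurable_itv `]-oo, t]).
    by rewrite set_itvE.
  rewrite /cdf /distribution /pushforward; congr (P _).
  apply/seteqP; split => w /=; rewrite in_itv/= /stdZ /shift_scale/= varE mE /t;
    by rewrite ler_pdivrMr// lerBlDr.
rewrite -normal_cdfE -EFinB abse_EFin lee_fin.
have := bernoulli_series_berry_esseen P B _ indepB bernBq _ _ meanq varq
  (normal_peak 1) normal_cdf t (normal_peak_gt0 (oner_neq0 R)) v0
  is_derive_normal_cdf normal_cdf01 normal_cdf_lt normal_cdf_gt.
rewrite {2}/t addrK mulfK ?gt_eqF// => /le_trans; apply; exact: rate.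
Qed.
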